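(* For every integer $n\ge 1$, the following identities hold. (i) $$\sum_{\sigma\in B_n}(-1)^{\lfloor \mathrm{fwex}(\sigma)/2\rfloor}=\begin{cases}(-1)^{\frac n2}2^nE_n & \text{if } n\text{ is even},\\ 0 & \text{if } n \text{ is odd}.\end{cases}$$ (ii) $$\sum_{\sigma\in D_n}(-1)^{\lfloor \mathrm{fwex}(\sigma)/2\rfloor}=(-1)^{\lfloor\frac{n+1}{2}\rfloor}2^{n-1} E_n.$$
   Context: Let $[n]=\{1,\dots,n\}$. A signed permutation of $[n]$ is a bijection $\sigma$ of $\{-n,\dots,-1,1,\dots,n\}$ onto itself with $\sigma(-i)=-\sigma(i)$ for all $i$; it is written $\sigma=\sigma_1\sigma_2\cdots\sigma_n$ with $\sigma_i=\sigma(i)$. $B_n$ is the set of signed permutations of $[n]$, and $D_n\subset B_n$ is the subset of those with an even number of negative entries among $\sigma_1,\dots,\sigma_n$. For $\sigma\in B_n$: $\mathrm{neg}(\sigma)=\#\{i\in[n]:\sigma_i<0\}$, $\mathrm{wex}(\sigma)=\#\{i\in[n]:\sigma_i\ge i\}$, and $\mathrm{fwex}(\sigma)=2\,\mathrm{wex}(\sigma)+\mathrm{neg}(\sigma)$. The Euler numbers $E_n$ are defined by $\sum_{n\ge 0}E_n\frac{x^n}{n!}=\tan x+\sec x$. *)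

(* Defs.v *)
From mathcomp Require Import all_boot all_order all_algebra all_fingroup.

Set Implicit Arguments.
Unset Strict Implicit.
Unset Printing Implicit Defensive.

Import Order.TTheory GRing.Theory Num.Theory.
Local Open Scope ring_scope.

(* The pair (i, b) stands for the integer +(i + 1) if b = false and
   -(i + 1) if b = true: the type is {-n, ..., -1, 1, ..., n}. *)
Notation pm n := ('I_n * bool)%type.

Definition pm_val (n : nat) (x : pm n) : int := (-1) ^+ x.2 * (x.1.+1)%:Z.

Definition pm_opp (n : nat) (x : pm n) : pm n := (x.1, ~~ x.2).

Definition pm_pos (n : nat) (i : 'I_n) : pm n := (i, false).

Lemma pm_val_inj n : injective (@pm_val n).
Proof.
move=> [i b] [j c]; rewrite /pm_val /= => e.
have := congr1 absz e; rewrite !abszMsign /= => -[/val_inj eij].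
by move: e; rewrite eij; case: b; case: c.
Qed.

Lemma pm_valP n (z : int) :
  (exists x : pm n, pm_val x = z) <-> (z != 0) && (`|z| <= n%:Z).
Proof.
split=> [[[i b] <-]|]; rewrite /pm_val /=.
  rewrite mulf_neq0 ?signr_eq0 //= normrM normrX normrN1 expr1n mul1r.
  by rewrite ger0_norm // lez_nat ltn_ord.
case/andP; case: z => [[|k]|k] // _.
  rewrite ger0_norm // lez_nat => lt_kn.
  by exists (Ordinal lt_kn, false); rewrite expr0 mul1r.
rewrite NegzE normrN ger0_norm // lez_nat => lt_kn.
by exists (Ordinal lt_kn, true); rewrite expr1 mulN1r.
Qed.

Lemma pm_val_opp n (x : pm n) : pm_val (pm_opp x) = - pm_val x.
Proof. by case: x => i [] /=; rewrite /pm_val /= ?expr0 ?expr1 ?mulN1r ?mul1r ?opprK. Qed.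

Definition signed_perms (n : nat) : {set {perm pm n}} :=
  [set s : {perm pm n} | [forall x, s (pm_opp x) == pm_opp (s x)]].

(* The letter sigma_(i + 1), for 0 <= i < n. *)
Definition letter (n : nat) (s : {perm pm n}) (i : 'I_n) : int :=
  pm_val (s (pm_pos i)).

Definition neg (n : nat) (s : {perm pm n}) : nat :=
  #|[set i : 'I_n | letter s i < 0]|.

Definition wex (n : nat) (s : {perm pm n}) : nat :=
  #|[set i : 'I_n | (i.+1)%:Z <= letter s i]|.

Definition fwex (n : nat) (s : {perm pm n}) : nat := (2 * wex s + neg s)%N.

Definition even_signed_perms (n : nat) : {set {perm pm n}} :=
  [set s in signed_perms n | ~~ odd (neg s)].

(* Formal power series over the rationals, as coefficient sequences. *)
Definition fps : Type := nat -> rat.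

Definition fps_mul (a b : fps) : fps :=
  fun n => \sum_(k < n.+1) a k * b (n - k)%N.

(* The first n coefficients of 1 / a, obtained by solving a * b = 1
   degree by degree; meaningful when a 0 != 0. *)
Fixpoint fps_inv_seq (a : fps) (n : nat) : seq rat :=
  if n is m.+1 then
    let s := fps_inv_seq a m in
    rcons s ((a 0%N)^-1 * ((m == 0%N)%:R - \sum_(k < m) s`_k * a (m - k)%N))
  else [::].

Definition fps_inv (a : fps) : fps := fun n => (fps_inv_seq a n.+1)`_n.

Lemma size_fps_inv_seq a n : size (fps_inv_seq a n) = n.
Proof. by elim: n => //= n IHn; rewrite size_rcons IHn. Qed.

Lemma nth_fps_inv_seq a n k : (k < n)%N -> (fps_inv_seq a n)`_k = fps_inv a k.
Proof.
elim: n => // n IHn; rewrite ltnS leq_eqVlt => /orP[/eqP->//|lt_kn].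
by rewrite /= nth_rcons size_fps_inv_seq lt_kn IHn.
Qed.

Lemma fps_mulVf (a : fps) (n : nat) :
  a 0%N != 0 -> fps_mul (fps_inv a) a n = (n == 0%N)%:R.
Proof.
move=> a0; rewrite /fps_mul big_ord_recr /= subnn {2}/fps_inv /= nth_rcons.
rewrite size_fps_inv_seq ltnn eqxx mulrAC mulVf // mul1r.
under [X in _ + (_ - X)]eq_bigr => k _ do rewrite nth_fps_inv_seq //.
by rewrite addrC subrK.
Qed.

Definition sin_fps : fps :=
  fun n => if odd n then (-1) ^+ (n %/ 2) / (n`!)%:R else 0.

Definition cos_fps : fps :=
  fun n => if odd n then 0 else (-1) ^+ (n %/ 2) / (n`!)%:R.

Definition sec_fps : fps := fps_inv cos_fps.

Definition tan_fps : fps := fps_mul sin_fps sec_fps.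

Definition euler (n : nat) : rat := (n`!)%:R * (tan_fps n + sec_fps n).

Lemma euler_egf (n : nat) : euler n / (n`!)%:R = tan_fps n + sec_fps n.
Proof. by rewrite /euler mulrAC divff ?mul1r // pnatr_eq0 -lt0n fact_gt0. Qed.

(* Main.v *)
From HB Require Import structures.
Require Import Defs.
From mathcomp Require Import all_boot all_order all_algebra all_fingroup all_field.
From mathcomp Require Import ring.

Set Implicit Arguments.
Unset Strict Implicit.
Unset Printing Implicit Defensive.

Import Order.TTheory GRing.Theory Num.Theory.
Local Open Scope ring_scope.

(** Why the identities hold.  Put S_n = sum over B_n of (-1)^wex i^neg, in the
    complex algebraic numbers.  As the half of fwex, rounded down, is wex plus
    the rounded-down half of neg, the real part of S_n is the sum over D_n and
    its imaginary part is the sum over the complement of D_n; so both claims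
    follow from the single formula (sum_signed_i)

      S_n = (1 - i) i^(n+1) 2^(n-1) E_n.

    Summing over the signs first (horner_wex_poly), S_n becomes a sum over
    ordinary permutations in which a weak excedance weighs p = i - 1 and any
    other position weighs q = i + 1.  Call A_n(p, q) this sum for
    indeterminates p and q.  Inserting a new maximum in the cycles of a
    permutation shows that q A_(n+1) = D (q A_n), for the derivation D
    with D p = D q = p q (wex_poly_rec).  Only the case p = X - 1, q = X + 1
    is needed, where D X = X^2 - 1; hence q A_n = D^n (X + 1), and
    (1 + i) S_n is, for n > 0, the value at i of D^n X.

    These values are the derivatives at 0 of the solution of u' = u^2 - 1,
    u(0) = i.  On the other side E = tan + sec solves 2 E' = 1 + E^2, E(0) = 1
    (euler_poly_ode, euler_rec), so that i E(2 i x) satisfies the same equation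
    as u; comparing the recurrences for Taylor coefficients gives
    (D^n X)(i) = i (2 i)^n E_n (iter_flowX_i). *)

(** * Derivation of the polynomial ring along u' = u^2 - 1 *)

Section Flow.
Variable K : comNzRingType.
Implicit Types f g : {poly K}.

(** This is the derivation of K[X] for which u |-> f(u) follows the
    differential equation u' = u^2 - 1: if u is a solution, then
    (f(u))' = (flow f)(u).  Hence evaluating [iter n flow f] at u(0) gives
    the n-th Taylor coefficient, times n!, of f(u). *)
Definition flow f : {poly K} := f^`() * ('X^2 - 1).

Lemma flow_is_additive : zmod_morphism flow.
Proof. by move=> f g; rewrite /flow derivB mulrBl. Qed.
HB.instance Definition _ := GRing.isZmodMorphism.Build _ _ flow flow_is_additive.

Lemma flowM f g : flow (f * g) = flow f * g + f * flow g.
Proof. by rewrite /flow derivM; ring. Qed.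

Lemma flow1 : flow 1 = 0.
Proof. by rewrite /flow derivC mul0r. Qed.

Lemma flowX : flow 'X = 'X^2 - 1.
Proof. by rewrite /flow derivX mul1r. Qed.

Lemma flow_prod (I : eqType) (r : seq I) (F : I -> {poly K}) : uniq r ->
  flow (\prod_(i <- r) F i) =
    \sum_(k <- r) flow (F k) * \prod_(i <- r | i != k) F i.
Proof.
elim: r => [|a r IHr] /=; first by rewrite !big_nil flow1.
case/andP=> ar /IHr {}IHr; rewrite big_cons flowM IHr !big_cons eqxx /=.
congr (_ * _ + _).
  rewrite [LHS]big_seq_cond [RHS]big_seq_cond; apply: eq_bigl => i.
  by case ir: (i \in r) => //=; apply/esym; apply: contraNneq ar => <-.
rewrite mulr_sumr; apply: eq_big_seq => k kr.
rewrite big_cons ifT; first by rewrite mulrCA.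
by apply: contraNneq ar => ->.
Qed.

Lemma iter_flowD n f g : iter n flow (f + g) = iter n flow f + iter n flow g.
Proof. by elim: n => //= n ->; rewrite raddfD. Qed.

Lemma iter_flow1 n : iter n flow 1 = (n == 0%N)%:R.
Proof. by elim: n => //= -[|n] -> /=; rewrite ?flow1 ?raddf0. Qed.

(** Leibniz rule: the sequence of the [iter n flow f] turns products in f into binomial
    convolutions, as the Taylor coefficients of f(u) must do. *)
Lemma iter_flowM n f g :
  iter n flow (f * g) =
    \sum_(k < n.+1) (iter k flow f * iter (n - k) flow g) *+ 'C(n, k).
Proof.
elim: n => [|n IHn]; first by rewrite big_ord1.
rewrite iterS IHn raddf_sum /=.
under eq_bigr => k _ do
  rewrite raddfMn /= flowM -!iterS -subSn -1?ltnS // mulrnDl.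
rewrite big_split /= [RHS]big_ord_recl [X in _ + X]big_ord_recl /= !bin0.
under [in RHS]eq_bigr => k _ do rewrite /bump /= add1n binS mulrnDr subSS.
rewrite big_split /= addrCA; congr (_ + _).
rewrite addrC; congr (_ + _).
by rewrite [in RHS]big_ord_recr /= bin_small // mulr0n addr0.
Qed.

(** Read on Taylor coefficients, this is u' = u^2 - 1 with u(0) = x. *)
Lemma iter_flowX_rec (x : K) n :
  (iter n.+1 flow 'X).[x] =
  (\sum_(k < n.+1) ((iter k flow 'X).[x] * (iter (n - k) flow 'X).[x])
     *+ 'C(n, k)) - (n == 0%N)%:R.
Proof.
rewrite iterSr flowX expr2.
have -> : iter n flow ('X * 'X - 1) = iter n flow ('X * 'X) - iter n flow 1.
  by elim: n => //= n ->; rewrite raddfB.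
rewrite iter_flowM iter_flow1 hornerD hornerN horner_sum.
congr (_ - _); last by case: (n == 0%N); rewrite ?hornerC ?horner0.
by apply: eq_bigr => k _; rewrite hornerMn hornerM.
Qed.

(** * Weak excedances of permutations *)

(** With p = X - 1 and q = X + 1, the flow sends both p and q to p q, which
    is what inserting a new maximum does to a weak excedance or to a strict
    anti-excedance. *)
Definition wex_weight (i j : nat) : {poly K} :=
  if (i <= j)%N then 'X - 1 else 'X + 1.

Definition wex_poly n : {poly K} :=
  \sum_(t : 'S_n) \prod_(i < n) wex_weight i (t i).

Lemma flow_wex_weight i j : flow (wex_weight i j) = ('X - 1) * ('X + 1).
Proof.
by rewrite /flow /wex_weight; case: leqP => _; rewrite !derivE; ring.
Qed.

Lemma lift_maxE n (i : 'I_n) : widen_ord (leqnSn n) i = lift ord_max i.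
Proof. by apply: val_inj; exact/esym/lift_max. Qed.

(** Every permutation of n + 1 points arises once by inserting the largest
    point in the cycle notation of a permutation of n points, either just
    after a point k or, for [k = ord_max], as a fixed point.  Injectivity
    suffices, both sides having (n + 1)! elements. *)
Lemma sum_perm_insert_max (R : nmodType) n (F : 'S_n.+1 -> R) :
  \sum_s F s =
  \sum_(t : 'S_n)
    \sum_(k < n.+1) F (tperm k ord_max * lift_perm ord_max ord_max t)%g.
Proof.
pose h (x : 'S_n * 'I_n.+1) :=
  (tperm x.2 ord_max * lift_perm ord_max ord_max x.1)%g.
have h_inj : injective h.
  have hV x : (h x)^-1%g ord_max = x.2.
    by apply: (canLR (permK _)); rewrite permM tpermL lift_perm_id.
  move=> [t k] [u l] e; have := congr1 (fun s : 'S_n.+1 => s^-1%g ord_max) e.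
  rewrite !hV /= => ekl; move: e; rewrite /h /= ekl => /mulgI etu; congr (_, _).
  apply/permP => i; apply: (@lift_inj _ ord_max).
  by rewrite -!(@lift_perm_lift _ ord_max ord_max) etu.
have h_bij : bijective h.
  by apply: inj_card_bij h_inj _; rewrite card_prod !card_Sn card_ord factS mulnC.
rewrite (reindex h) /=; last exact: onW_bij.
by rewrite pair_bigA.
Qed.

(** Inserting the maximum after j replaces the factor of j by p q: now j maps
    to the maximum, a weak excedance, and the maximum maps to the old image of
    j, below it.  The other positions are unaffected, and a new fixed point is
    a weak excedance, of weight p. *)
Lemma wex_weight_insert n (t : 'S_n) (k : 'I_n.+1) :
  let s := (tperm k ord_max * lift_perm ord_max ord_max t)%g in
  \prod_(i < n.+1) wex_weight i (s i) =
  if unlift ord_max k is Some j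
  then ('X - 1) * ('X + 1) * \prod_(i < n | i != j) wex_weight i (t i)
  else (\prod_(i < n) wex_weight i (t i)) * ('X - 1).
Proof.
rewrite /= big_ord_recr /=; case: unliftP => [j|] -> /=.
  set s := (tperm _ _ * _)%g.
  have s_max : s ord_max = t j :> nat.
    by rewrite permM tpermR lift_perm_lift; exact: lift_max.
  have s_j : s (lift ord_max j) = n :> nat.
    by rewrite permM tpermL lift_perm_id.
  have s_i i : i != j -> s (lift ord_max i) = t i :> nat.
    move=> ij; rewrite permM tpermD ?neq_lift ?lift_perm_lift //.
      exact: lift_max.
    by rewrite (inj_eq (@lift_inj _ _)) eq_sym.
  rewrite s_max (bigD1 j) //= lift_maxE s_j {1}/wex_weight ltnW //.
  rewrite {2}/wex_weight leqNgt ltn_ord /= mulrAC; congr (_ * _).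
  by apply: eq_bigr => i ij; rewrite lift_maxE s_i.
rewrite tperm1 mul1g lift_perm_id /= {2}/wex_weight leqnn; congr (_ * _).
apply: eq_bigr => i _; rewrite lift_maxE lift_perm_lift.
by congr (wex_weight _ _); exact: lift_max.
Qed.

(** The product rule chooses one factor of the product and replaces it by p q,
    which is the insertion after that position.  The extra factor q = X + 1
    has flow p q as well, and so accounts for the new fixed point. *)
Lemma wex_poly_rec n :
  ('X + 1) * wex_poly n.+1 = flow (('X + 1) * wex_poly n).
Proof.
rewrite {1}/wex_poly sum_perm_insert_max flowM raddf_sum /=.
have -> : flow ('X + 1) = ('X - 1) * ('X + 1).
  by rewrite /flow !derivE; ring.
rewrite !mulr_sumr -big_split /=; apply: eq_bigr => t _.
under eq_bigr => k _ do rewrite wex_weight_insert.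
rewrite big_ord_recr /= unlift_none flow_prod ?index_enum_uniq //.
under eq_bigr => k _ do rewrite lift_maxE liftK.
under [X in _ = _ + _ * X]eq_bigr => k _ do rewrite flow_wex_weight.
by ring.
Qed.

Lemma wex_poly_flow n : ('X + 1) * wex_poly n = iter n flow ('X + 1).
Proof.
elim: n => [|n IHn]; last by rewrite wex_poly_rec IHn.
rewrite /wex_poly; under eq_bigr => t _ do rewrite big_ord0.
by rewrite sumr_const card_Sn mulr1.
Qed.

End Flow.

(** * The differential equation of tan + sec *)

Lemma dvdp_XnP (F : fieldType) N (p : {poly F}) :
  reflect (forall i, (i < N)%N -> p`_i = 0) ('X^N %| p).
Proof.
rewrite /dvdp -Pdiv.IdomainMonic.take_poly_modp; apply: (iffP eqP) => [e i lt_iN | e].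
  by have := coef_take_poly N p i; rewrite e coef0 lt_iN.
by apply/polyP => i; rewrite coef_take_poly coef0; case: ifP => // /e.
Qed.

Lemma dvdp_Xn_deriv (F : fieldType) N (p : {poly F}) :
  'X^(N.+1) %| p -> 'X^N %| p^`().
Proof.
by move/dvdp_XnP => e; apply/dvdp_XnP => i ltiN; rewrite coef_deriv e ?mul0rn.
Qed.

Lemma coef_poly_mul (a b : fps) N n : (n < N)%N ->
  (\poly_(i < N) a i * \poly_(i < N) b i)`_n = fps_mul a b n.
Proof.
move=> ltnN; rewrite coefM; apply: eq_bigr => k _.
by rewrite !coef_poly !ifT // (leq_ltn_trans _ ltnN) ?leq_subr // -ltnS.
Qed.

(** Power series are handled through polynomial truncations, identities
    between series becoming divisibility by a power of X; each derivative
    costs one degree of precision. *)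
Section Euler.
Variable N : nat.
Let C := \poly_(i < N.+1) cos_fps i.
Let S := \poly_(i < N.+1) sin_fps i.
Let P := \poly_(i < N.+1) (tan_fps i + sec_fps i).

Lemma deriv_cos_poly : 'X^N %| C^`() + S.
Proof.
apply/dvdp_XnP => i ltiN; rewrite coefD coef_deriv !coef_poly ltnS ltiN.
rewrite (leqW ltiN) /cos_fps /sin_fps /=; case oi: (odd i) => /=; last first.
  by rewrite mul0rn addr0.
rewrite -[_ *+ _]mulr_natr factS [(_ * i`!)%N]mulnC natrM invfM mulrA mulfVK ?pnatr_eq0 //.
have -> : (i.+1 %/ 2 = (i %/ 2).+1)%N by rewrite !divn2 -[i.+1./2]/(uphalf i) uphalf_half oi.
by rewrite exprS mulN1r mulNr addNr.
Qed.

Lemma deriv_sin_poly : 'X^N %| S^`() - C.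
Proof.
apply/dvdp_XnP => i ltiN; rewrite coefB coef_deriv !coef_poly ltnS ltiN.
rewrite (leqW ltiN) /cos_fps /sin_fps /=; case oi: (odd i) => /=.
  by rewrite mul0rn subr0.
rewrite -[_ *+ _]mulr_natr factS [(_ * i`!)%N]mulnC natrM invfM mulrA mulfVK ?pnatr_eq0 //.
have -> : (i.+1 %/ 2 = i %/ 2)%N by rewrite !divn2 -[i.+1./2]/(uphalf i) uphalf_half oi.
by rewrite subrr.
Qed.

Lemma cos_fps0 : cos_fps 0 = 1.
Proof. by rewrite /cos_fps /= divr1. Qed.

Lemma sin_fps0 : sin_fps 0 = 0.
Proof. by []. Qed.

Lemma coprime_cos_poly M : coprimep 'X^M C.
Proof.
apply: coprimep_expl; rewrite coprimep_sym coprimepX /root horner_coef0.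
by rewrite coef_poly cos_fps0.
Qed.

(** This is cos (tan + sec) = 1 + sin. *)
Lemma cos_mul_euler_poly : 'X^(N.+1) %| C * P - (1 + S).
Proof.
pose Z := \poly_(i < N.+1) sec_fps i; pose T := \poly_(i < N.+1) tan_fps i.
have e1 : 'X^(N.+1) %| Z * C - 1.
  apply/dvdp_XnP => i ltiN; rewrite coefB coef_poly_mul // fps_mulVf.
    by rewrite coef1 subrr.
  by rewrite cos_fps0 oner_eq0.
have e2 : 'X^(N.+1) %| T - S * Z.
  apply/dvdp_XnP => i ltiN; rewrite coefB coef_poly_mul // coef_poly ltiN.
  exact: subrr.
have -> : P = T + Z.
  by apply/polyP => i; rewrite coefD !coef_poly; case: ifP; rewrite ?addr0.
have -> : C * (T + Z) - (1 + S) = C * (T - S * Z) + (1 + S) * (Z * C - 1).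
  by ring.
by rewrite dvdp_add ?dvdp_mull.
Qed.

(** The derivative of cos^2 + sin^2 vanishes, and in characteristic zero only
    the constant term is then left. *)
Lemma cos2_sin2_poly : 'X^N %| C * C + S * S - 1.
Proof.
have d : 'X^N %| (C * C + S * S)^`().
  have -> : (C * C + S * S)^`() = (2%:R * C) * (C^`() + S) + (2%:R * S) * (S^`() - C).
    by rewrite derivD !derivM; ring.
  by rewrite dvdp_add ?dvdp_mull ?deriv_cos_poly ?deriv_sin_poly.
apply/dvdp_XnP => -[|i] ltiN.
  rewrite !coefB !coefD !coefM !big_ord1 !coef_poly cos_fps0 sin_fps0 coef1.
  by rewrite /=; ring.
have /dvdp_XnP/(_ i (ltnW ltiN))/eqP := d.
rewrite coef_deriv mulrn_eq0 /= => /eqP; rewrite coefB coef1 => ->.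
by rewrite subr0.
Qed.

(** The equation 2 E' = 1 + E^2 for E = tan + sec.  Multiplied by cos^2, a
    unit among power series, it becomes a combination of cos E = 1 + sin, of
    its derivative, and of cos^2 + sin^2 = 1. *)
Lemma euler_poly_ode : 'X^N %| 2%:R * P^`() - (1 + P * P).
Proof.
rewrite -(@Gauss_dvdpr _ _ C) ?coprime_cos_poly //.
rewrite -(@Gauss_dvdpr _ _ C) ?coprime_cos_poly //.
have e1 := dvdp_Xn_deriv cos_mul_euler_poly.
have e2 : 'X^N %| C * P - (1 + S).
  by apply: dvdp_trans cos_mul_euler_poly; rewrite dvdp_exp2l.
have e3 := cos2_sin2_poly.
have e4 := deriv_cos_poly; have e5 := deriv_sin_poly.
rewrite (_ : C * _ = 2%:R * C * (C * P - (1 + S))^`()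
   + - (2%:R * C * P) * (C^`() + S) + 2%:R * C * (S^`() - C)
   + (2%:R * S - (C * P + 1 + S)) * (C * P - (1 + S)) + 1 * (C * C + S * S - 1)).
  by do 4!apply: dvdp_add _ (dvdp_mull _ _) => //; apply: dvdp_mull.
by rewrite derivB derivD derivM derivC; ring.
Qed.

End Euler.

Lemma euler0 : euler 0 = 1.
Proof.
have /dvdp_XnP/(_ 0%N (ltn0Sn _))/eqP := cos_mul_euler_poly 0.
rewrite coefB coefD coef_poly_mul // /fps_mul big_ord1 subnn cos_fps0 mul1r.
rewrite coef1 coef_poly sin_fps0 addr0 subr_eq0 => /eqP e.
by rewrite /euler e mul1r.
Qed.

Lemma euler_rec n :
  2%:R * euler n.+1 =
  (\sum_(k < n.+1) (euler k * euler (n - k)) *+ 'C(n, k)) + (n == 0%N)%:R.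
Proof.
have /dvdp_XnP/(_ n (ltnSn n))/eqP := euler_poly_ode n.+1.
rewrite coefB coefD coef_poly_mul // mulr_natl coefMn coef_deriv coef_poly.
rewrite ltnS leqnn coef1 -euler_egf subr_eq0 => /eqP/(congr1 ( *%R (n`!)%:R)).
have f0 m : (m`!)%:R != 0 :> rat by rewrite pnatr_eq0 -lt0n fact_gt0.
have s0 : n.+1%:R != 0 :> rat by rewrite pnatr_eq0.
have -> : (n`!)%:R * (euler n.+1 / (n.+1`!)%:R *+ n.+1 *+ 2) = 2%:R * euler n.+1.
  rewrite -[_ *+ 2]mulr_natr -[_ *+ n.+1]mulr_natr factS natrM.
  by move: n.+1%:R s0 => m m0; field; rewrite m0 f0.
move=> ->; rewrite mulrDr addrC /fps_mul mulr_sumr; congr (_ + _).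
  apply: eq_bigr => k _; rewrite -!euler_egf -mulr_natl.
  have le_kn : (k <= n)%N by rewrite -ltnS.
  by rewrite -(bin_fact le_kn) !natrM; field; rewrite !f0.
by case: n {f0 s0} => [|n] /=; rewrite ?mulr1 ?mulr0.
Qed.

(** * Signed permutations *)

Section Signing.
Variable n : nat.
Implicit Types (t : 'S_n) (e : {ffun 'I_n -> bool}) (s : {perm pm n}).

(** A signed permutation is a permutation of the absolute values together with
    an arbitrary choice of signs. *)
Definition sign_fun t e (x : pm n) : pm n := (t x.1, x.2 (+) e x.1).

Lemma sign_fun_inj t e : injective (sign_fun t e).
Proof. by move=> [i b] [j c] [/perm_inj <-] /addIb <-. Qed.

Definition sign_perm (te : 'S_n * {ffun 'I_n -> bool}) : {perm pm n} :=
  perm (@sign_fun_inj te.1 te.2).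

Lemma sign_permE t e i : sign_perm (t, e) (pm_pos i) = (t i, e i).
Proof. by rewrite permE. Qed.

Lemma sign_perm_inj : injective sign_perm.
Proof.
move=> [t e] [u f] eq_s.
have eq_i i : (t i, e i) = (u i, f i) by rewrite -!sign_permE eq_s.
by congr (_, _); [apply/permP | apply/ffunP] => i; case: (eq_i i).
Qed.

Lemma signed_permsE : signed_perms n = [set sign_perm te | te in predT].
Proof.
apply/setP => s; rewrite inE; apply/forallP/imsetP => [sN|[[t e] _ ->] x].
  have sE i b : s (i, b) = ((s (pm_pos i)).1, b (+) (s (pm_pos i)).2).
    case: b; last by case: (s _).
    by rewrite -[(i, true)]/(pm_opp (pm_pos i)) (eqP (sN _)); case: (s _).
  have t_inj : injective (fun i => (s (pm_pos i)).1).
    move=> i j eq_ij; have := sE j ((s (pm_pos i)).2 (+) (s (pm_pos j)).2).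
    by rewrite addbK /= -eq_ij -surjective_pairing => /perm_inj [].
  exists (perm t_inj, [ffun i => (s (pm_pos i)).2]) => //.
  by apply/permP => -[i b]; rewrite sE !permE /sign_fun /= !permE ffunE.
by rewrite !permE /sign_fun /pm_opp /= addNb.
Qed.

(** Because the signs of the letters are independent, summing over them
    factors. *)
Lemma sum_signed_perms (R : comNzSemiRingType) (F : 'I_n -> pm n -> R) :
  \sum_(s in signed_perms n) \prod_i F i (s (pm_pos i)) =
  \sum_(t : 'S_n) \prod_i (F i (t i, true) + F i (t i, false)).
Proof.
rewrite signed_permsE big_imset /=; last by move=> x y _ _; apply: sign_perm_inj.
rewrite -(pair_bigA _ (fun t e => \prod_i F i (sign_perm (t, e) (pm_pos i)))) /=.
apply: eq_bigr => t _.
transitivity (\prod_i \sum_(b : bool) F i (t i, b)); last first.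
  by apply: eq_bigr => i _; rewrite big_bool.
rewrite bigA_distr_bigA; apply: eq_bigr => e _.
by apply: eq_bigr => i _; rewrite sign_permE.
Qed.

Definition letter_weight (K : nzRingType) (x : K) (i : 'I_n) (l : pm n) : K :=
  if l.2 then x else if (i <= l.1)%N then -1 else 1.

Lemma letter_weight_prod (K : comNzRingType) (x : K) s :
  \prod_i letter_weight x i (s (pm_pos i)) = (-1) ^+ wex s * x ^+ neg s.
Proof.
rewrite /wex /neg -!prodr_const [X in _ = X * _]big_mkcond [X in _ = _ * X]big_mkcond.
rewrite -big_split; apply: eq_bigr => i _ /=.
rewrite !inE /letter /letter_weight; case: (s _) => j [] /=; rewrite /pm_val /=.
  by rewrite mul1r.
by rewrite expr0 mul1r lez_nat ltnS mulr1.
Qed.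

(** With a negative letter weighing i, the two signs of a letter contribute
    together i - 1 at a weak excedance of the absolute values, and i + 1
    elsewhere: exactly the weights X - 1 and X + 1 at X = i. *)
Lemma horner_wex_poly :
  (wex_poly algC n).['i] =
  \sum_(s in signed_perms n) (-1) ^+ wex s * 'i ^+ neg s.
Proof.
under eq_bigr => s _ do rewrite -letter_weight_prod.
rewrite sum_signed_perms horner_sum; apply: eq_bigr => t _.
rewrite horner_prod; apply: eq_bigr => i _.
rewrite /letter_weight /wex_weight /=; case: ifP => _.
  by rewrite hornerD hornerN hornerX hornerC.
by rewrite hornerD hornerX hornerC.
Qed.

(** Since i ^ (2 m) = (-1) ^ m, weighing the negative letters by i realizes
    the rounded-down half of their number, and separates the two parities of
    this number into real and imaginary parts. *)
Lemma sign_half_fwex (s : {perm pm n}) :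
  (-1) ^+ wex s * 'i ^+ neg s =
  (if odd (neg s) then 'i else 1) * (-1) ^+ (fwex s %/ 2) :> algC.
Proof.
rewrite /fwex mulnC divnMDl // exprD mulrCA; congr (_ * _).
rewrite -{1}[neg s]odd_double_half exprD -muln2 mulnC exprM sqrCi divn2.
by case: (odd _).
Qed.

End Signing.

(** The solution of u' = u^2 - 1 with u(0) = i is u(x) = i E(2 i x), where
    E = tan + sec satisfies 2 E' = 1 + E^2 and E(0) = 1. *)
Lemma iter_flowX_i n :
  (iter n (@flow algC) 'X).['i] = 'i * (2%:R * 'i) ^+ n * ratr (euler n).
Proof.
elim/ltn_ind: n => -[_|n IHn]; first by rewrite /= hornerX euler0 rmorph1 !mulr1.
rewrite iter_flowX_rec.
have -> : 'i * (2%:R * 'i) ^+ n.+1 * ratr (euler n.+1)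
   = - (2%:R * 'i) ^+ n * ratr (2%:R * euler n.+1) :> algC.
  by rewrite [ratr (2%:R * _)]rmorphM /= ratr_nat exprS -[in RHS]mulN1r -sqrCi; ring.
rewrite euler_rec rmorphD rmorph_nat rmorph_sum /= mulrDr mulr_sumr.
congr (_ + _); last by case: n {IHn} => [|n] /=; rewrite ?expr0 ?mulr1 ?mulr0 ?oppr0.
apply: eq_bigr => k _; have le_kn : (k <= n)%N by rewrite -ltnS.
rewrite !IHn ?ltnS ?leq_subr // rmorphMn /= [ratr (euler k * _)]rmorphM /= mulrnAr; congr (_ *+ _).
have -> : (2%:R * 'i) ^+ n = (2%:R * 'i) ^+ k * (2%:R * 'i) ^+ (n - k) :> algC.
  by rewrite -exprD subnKC.
by rewrite -[in RHS]mulN1r -sqrCi; ring.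
Qed.

(** The complex formula whose real and imaginary parts are the two parities
    of neg. *)
Lemma sum_signed_i n : (0 < n)%N ->
  \sum_(s in signed_perms n) (-1) ^+ wex s * 'i ^+ neg s
  = (1 - 'i) * 'i ^+ n.+1 * 2%:R ^+ n.-1 * ratr (euler n) :> algC.
Proof.
case: n => // n _; rewrite -horner_wex_poly.
have := congr1 (horner^~ 'i) (wex_poly_flow algC n.+1).
rewrite iter_flowD hornerD iter_flowX_i iter_flow1 horner0 addr0.
rewrite hornerM hornerD hornerX hornerC => e.
(* The left factor (X + 1).['i] is cleared through (1 - i)(1 + i) = 2. *)
have two : (1 - 'i) * ('i + 1) = 2%:R :> algC.
  by transitivity (1 - 'i ^+ 2 : algC); [ring | rewrite sqrCi opprK].
have two0 : 2%:R != 0 :> algC by rewrite pnatr_eq0.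
by apply: (mulfI two0); rewrite -{1}two -[LHS]mulrA e exprMn !exprS; ring.
Qed.

Theorem corollary1p5 (n : nat) (hn : (1 <= n)%N) :
  (\sum_(s in signed_perms n) (-1) ^+ (fwex s %/ 2) =
     (if odd n then 0 else (-1) ^+ (n %/ 2) * 2 ^+ n * euler n) :> rat)
  /\
  (\sum_(s in even_signed_perms n) (-1) ^+ (fwex s %/ 2) =
     (-1) ^+ (n.+1 %/ 2) * 2 ^+ n.-1 * euler n :> rat).
Proof.
pose w s : rat := (-1) ^+ (@fwex n s %/ 2).
pose a := \sum_(s in even_signed_perms n) w s.
pose b := \sum_(s in signed_perms n | odd (neg s)) w s.
pose r : rat := 2 ^+ n.-1 * euler n.
have sumE : \sum_(s in signed_perms n) w s = b + a.
  rewrite (bigID (fun s => odd (neg s))) /=; congr (_ + _).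
  by apply: eq_bigl => s; rewrite !inE.
have real_rat (q : rat) : (ratr q : algC) \is Num.real by rewrite Creal_Crat ?Crat_rat.
have sum_i : ratr a + 'i * ratr b = (1 - 'i) * 'i ^+ n.+1 * ratr r :> algC.
  have -> : ratr r = 2%:R ^+ n.-1 * ratr (euler n) :> algC.
    by rewrite /r [ratr (_ ^+ _ * euler n)]rmorphM /= rmorphXn /= ratr_nat.
  rewrite [RHS]mulrA -sum_signed_i //.
  rewrite [RHS](bigID (fun s => odd (neg s))) /= [RHS]addrC !rmorph_sum mulr_sumr /=.
  congr (_ + _); apply: eq_big => s; rewrite ?inE //.
    by case/andP=> _ /negbTE os; rewrite sign_half_fwex os mul1r rmorph_sign.
  by case/andP=> _ os; rewrite sign_half_fwex os rmorph_sign.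
pose sg : rat := (-1) ^+ (n.+1 %/ 2).
have [aE bE] : a = sg * r /\ b = (-1) ^+ odd n * sg * r.
  (* i ^ (n + 1) is real or imaginary according to the parity of n. *)
  have rhsE : (1 - 'i) * 'i ^+ n.+1 * ratr r
      = ratr (sg * r) + 'i * ratr ((-1) ^+ odd n * sg * r) :> algC.
    have mul_i : (1 - 'i) * 'i = 1 + 'i :> algC.
      by transitivity ('i - 'i ^+ 2 : algC); [ring | rewrite sqrCi opprK addrC].
    clearbody r; rewrite !rmorphM /= !rmorph_sign.
    rewrite -{1}[n.+1]odd_double_half exprD -muln2 mulnC exprM sqrCi -divn2 /=.
    case: (odd n) => /=; first by ring.
    by rewrite expr1 [(1 - 'i) * _]mulrA mul_i; ring.
  rewrite rhsE in sum_i; split; apply: (fmorph_inj (ratr : rat -> algC)).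
    by have := congr1 (fun z => 'Re z) sum_i; rewrite !Re_rect.
  by have := congr1 (fun z => 'Im z) sum_i; rewrite !Im_rect.
split; last by rewrite -/a aE /r mulrA.
rewrite sumE aE bE /r /sg; case: ifP => on /=.
  by rewrite expr1; ring.
have -> : (n.+1 %/ 2 = n %/ 2)%N by rewrite !divn2 -[n.+1./2]/(uphalf n) uphalf_half on.
have -> : 2 ^+ n = 2 * 2 ^+ n.-1 :> rat by rewrite -exprS prednK.
by ring.
Qed.
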